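(* There is an absolute constant $C>0$ such that the following holds. For every integer $n \ge 1$, every integer $k \ge 1$, and every metric $M_T$ induced by an $n$-vertex tree $T$ with positive edge weights, there is a $1$-spanner $H$ for $M_T$ with hop-diameter $k$ and lightness at most $C\, k\, n^{2/k}$.
   Context: The metric $M_T$ induced by a weighted tree $T$ has point set $V(T)$ and distance $\delta_T(u,v)$ equal to the weight of the (unique) path between $u$ and $v$ in $T$. For a finite metric space $M_X=(X,\delta_X)$, viewed as the complete graph on $X$ where edge $(u,v)$ has weight $\delta_X(u,v)$, a subgraph $H=(X,E)$ with $E\subseteq\binom{X}{2}$ is a $t$-spanner if $\delta_H(u,v)\le t\,\delta_X(u,v)$ for all $u,v\in X$, where $\delta_H$ is the shortest-path distance in $H$. A $t$-spanner has hop-diameter $k$ if for every $u,v\in X$ there is a path in $H$ between $u$ and $v$ with at most $k$ edges and total weight at most $t\,\delta_X(u,v)$. The lightness of $H$ is the total weight of its edges divided by the weight of a minimum spanning tree of $M_X$. *)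

(* Defs.v *)
From mathcomp Require Import all_boot all_order all_algebra.
From mathcomp Require Import all_classical all_reals all_analysis.
Set Implicit Arguments.
Unset Strict Implicit.
Unset Printing Implicit Defensive.
Import Order.TTheory GRing.Theory Num.Theory.
Local Open Scope classical_set_scope.
Local Open Scope ring_scope.

Record sgraph (V : finType) := SGraph {
  adj :> rel V;
  adj_sym : symmetric adj;
  adj_irr : irreflexive adj }.

(* As in path.v, the path u :: p is given by its first vertex u and the list p
   of the following ones, so that size p is its number of edges. *)
Definition is_path (V : finType) (G : sgraph V) (u v : V) (p : seq V) : bool :=
  [&& path G u p, last u p == v & uniq (u :: p)].

Definition connected_graph (V : finType) (G : sgraph V) : Prop :=
  forall u v : V, exists p, is_path G u v p.

(* A one-edge graph has a ucycle of size 2, hence the bound on the size. *)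
Definition acyclic (V : finType) (G : sgraph V) : Prop :=
  forall c : seq V, (2 < size c)%N -> ~ ucycle G c.

Definition is_tree (V : finType) (G : sgraph V) : Prop :=
  connected_graph G /\ acyclic G.

Fixpoint path_weight (R : realType) (V : finType) (w : V -> V -> R)
    (u : V) (p : seq V) : R :=
  if p is v :: q then w u v + path_weight w v q else 0.

(* The values of wt outside the edges are irrelevant. *)
Record wtree (R : realType) (V : finType) := WTree {
  tgraph :> sgraph V;
  tgraph_tree : is_tree tgraph;
  wt : V -> V -> R;
  wt_sym : forall u v, tgraph u v -> wt u v = wt v u;
  wt_gt0 : forall u v, tgraph u v -> 0 < wt u v }.

(* There is exactly one path from u to v in a tree, and xget returns it. *)
Definition tree_dist (R : realType) (V : finType) (T : wtree R V)
    (u v : V) : R :=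
  path_weight (wt T) u (xget [::] [set p : seq V | is_path T u v p]).

(* In the definitions below d is the distance of a metric on V, and a graph H
   on V is a subgraph of the complete graph with edge weights d. *)

(* The value is +oo when no path of H joins u to v. *)
Definition graph_dist (R : realType) (V : finType) (d : V -> V -> R)
    (H : sgraph V) (u v : V) : \bar R :=
  ereal_inf [set (path_weight d u p)%:E | p in [set p : seq V | is_path H u v p]].

Definition spanner (R : realType) (V : finType) (d : V -> V -> R) (t : R)
    (H : sgraph V) : Prop :=
  forall u v : V, (graph_dist d H u v <= (t * d u v)%:E)%E.

Definition hop_diameter (R : realType) (V : finType) (d : V -> V -> R) (t : R)
    (H : sgraph V) (k : nat) : Prop :=
  forall u v : V, exists p : seq V,
    [/\ is_path H u v p, (size p <= k)%N & path_weight d u p <= t * d u v].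

(* The sum over ordered pairs counts each edge twice. *)
Definition graph_weight (R : realType) (V : finType) (d : V -> V -> R)
    (H : sgraph V) : R :=
  (\sum_(u : V) \sum_(v : V | H u v) d u v) / 2.

(* If V is nonempty, this is an infimum over a finite nonempty set, hence a
   minimum. *)
Definition mst_weight (R : realType) (V : finType) (d : V -> V -> R) : R :=
  inf [set graph_weight d S | S in [set S : sgraph V | is_tree S]].

(* If V has a single point, this is 0 / 0 = 0. *)
Definition lightness (R : realType) (V : finType) (d : V -> V -> R)
    (H : sgraph V) : R :=
  graph_weight d H / mst_weight d.

(* Main.v *)
Require Import Defs.
From mathcomp Require Import all_boot all_order all_algebra.
From mathcomp Require Import all_classical all_reals all_analysis.
Import Order.TTheory GRing.Theory Num.Theory.

(** Root the tree and identify each edge with its lower endpoint [x]; it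
separates [u] from [v] when [x] is an ancestor of exactly one of them, and
[tree_dist u v] is the sum of the weights of the separating edges. So it
suffices to find a set of pairs such that every tree edge separates
[O(k n^(2/k))] of them (its load), and such that any two vertices are joined by
at most [k] pairs visiting the vertices of their tree path in order. The edges
of a spanning tree cross every cut of the tree, hence the total weight of the
tree is a lower bound for the minimum spanning tree.

With [q ^ k >= n] and [l = 2 q^2], the number of hops is reduced by two as
follows. Call [y] a hub if the number of vertices below [y], divided by [l] and
rounded down, is positive and larger than for every strict descendant of [y].
At most [2 n / l] vertices are hubs; removing them leaves components of at most
[l] vertices, each adjacent to at most two hubs. Joining every vertex to the
hubs visible from it and, recursively, the centroid of each piece of a
component to all vertices of that piece costs a load [O(l)]. Two vertices in
the same component are then two hops apart, and the other pairs are routed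
through their first and last hubs, which are joined recursively by [k - 2]
hops. *)

Set Implicit Arguments.
Unset Strict Implicit.
Unset Printing Implicit Defensive.

(** * Rooted orders and betweenness *)

Record rooted_order (V : finType) := RootedOrder {
  ancestor : rel V;
  anc_refl : reflexive ancestor;
  anc_trans : transitive ancestor;
  anc_anti : antisymmetric ancestor;
  anc_chain : forall x y v, ancestor x v -> ancestor y v ->
    ancestor x y || ancestor y x;
  apex : V;
  anc_apex : forall v, ancestor apex v }.

Section RootedOrder.
Variables (V : finType) (F : rooted_order V).
Implicit Types (u v w x y z : V) (B : pred V).
Local Notation anc := (ancestor F).

(* A vertex [x] stands for the edge joining it to its parent, and [sep x u v]
   says that this edge lies on the path from [u] to [v]. *)
Definition sep x u v := anc x u != anc x v.

(** This says that [z] lies on the tree path from [u] to [v]: the path is the intersection of the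
    half-trees containing both ends. In this form many facts reduce to a Boolean case analysis for
    each edge. *)
Definition btw u z v :=
  [forall x, (anc x u == anc x v) ==> (anc x z == anc x u)].

Lemma sepC x u v : sep x u v = sep x v u.
Proof. by rewrite /sep eq_sym. Qed.

Lemma sepxx x u : sep x u u = false.
Proof. by rewrite /sep eqxx. Qed.

Lemma sep_eq u v : (forall x, sep x u v = false) -> u = v.
Proof.
move=> h; apply: (@anc_anti V F); apply/andP; split.
  by move: (h u); rewrite /sep anc_refl; case: (anc u v).
by move: (h v); rewrite /sep anc_refl; case: (anc v u).
Qed.

Lemma btwP u z v :
  reflect ((anc z u || anc z v) /\ forall x, anc x u -> anc x v -> anc x z)
          (btw u z v).
Proof.
apply: (iffP forallP) => [h | [h1 h2] x].
  split=> [|x xu xv]; last by move: (h x); rewrite xu xv => /eqP.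
  by move: (h z); rewrite anc_refl; case: (anc z u); case: (anc z v).
apply/implyP => /eqP e; apply/eqP; case xu: (anc x u).
  by rewrite h2 // -e.
by apply/negP => xz; case/orP: h1 => /(anc_trans xz); rewrite -?e xu.
Qed.

Lemma btwC u z v : btw u z v = btw v z u.
Proof.
by apply: eq_forallb => x; case: (anc x u); case: (anc x v); case: (anc x z).
Qed.

Lemma btwl u v : btw u u v.
Proof. by apply/forallP => x; rewrite eqxx implybT. Qed.

Lemma btwr u v : btw u v v.
Proof. by rewrite btwC btwl. Qed.

Lemma btw_refl u z : btw u z u -> z = u.
Proof.
move=> /forallP h; apply: sep_eq => x; move: (h x); rewrite eqxx /sep => /eqP ->.
by rewrite eqxx.
Qed.

(** A common ancestor of [u] and [v] is comparable with [x], and [x] cannot be above it, since [x]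
    would then be above both ends. *)
Lemma sep_btw x u v : sep x u v -> btw u x v.
Proof.
move=> s; apply/btwP; split; first by move: s; rewrite /sep; do 2!case: (anc _ _).
move=> z zu zv; move: s; rewrite /sep.
case xu: (anc x u); case xv: (anc x v) => // _.
  by case/orP: (anc_chain zu xu) => // /anc_trans /(_ zv); rewrite xv.
by case/orP: (anc_chain zv xv) => // /anc_trans /(_ zu); rewrite xu.
Qed.

Lemma btw_transl u c v z : btw u c v -> btw u z c -> btw u z v.
Proof.
move=> /forallP h1 /forallP h2; apply/forallP => x; move: (h1 x) (h2 x).
by case: (anc x u); case: (anc x v); case: (anc x c); case: (anc x z).
Qed.

Lemma btw_transr u c v z : btw u c v -> btw u z c -> btw z c v.
Proof.
move=> /forallP h1 /forallP h2; apply/forallP => x; move: (h1 x) (h2 x).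
by case: (anc x u); case: (anc x v); case: (anc x c); case: (anc x z).
Qed.

Lemma btw_anti u z v : btw u z v -> btw z u v -> u = z.
Proof.
move=> /forallP h1 /forallP h2; apply: sep_eq => x; move: (h1 x) (h2 x).
by rewrite /sep; case: (anc x u); case: (anc x v); case: (anc x z).
Qed.

(** This makes [conn] transitive. If [b] is above [u] and off the path from [u] to [w], it is also
    above [w]; a common ancestor of [w] and [v] not above [b] would put [b] back on that path. *)
Lemma btw_split u b v w : btw u b v -> btw u b w || btw w b v.
Proof.
wlog bu : u v / anc b u => [hw ub|].
  case/btwP: (ub) => /orP[bu|bv] _; first exact: hw.
  by rewrite orbC [btw u b w]btwC [btw w b v]btwC; apply: hw => //; rewrite btwC.
move=> /btwP[_ h]; case/boolP: (btw u b w) => //= nbw.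
have bw : anc b w.
  apply: contraR nbw => nbw; apply: sep_btw; by rewrite /sep bu (negbTE nbw).
apply/btwP; rewrite bw; split=> // x xw xv; apply: contraR nbw => nxb.
apply/btwP; rewrite bu; split=> // z zu zw.
case/orP: (anc_chain xw zw) => [xz|zx]; last exact: h (anc_trans zx xv).
by case/negP: nxb; apply: h (anc_trans xz zu) xv.
Qed.

(** The unweighted tree distance, a measure for finding the nearest vertex on a path and for
    induction along it. *)
Definition sep_dist u v := #|[pred x | sep x u v]|.

Lemma sep_dist_lt u z y : btw u z y -> z != y -> sep_dist u z < sep_dist u y.
Proof.
move=> /forallP h; apply: contraNltn => le; apply/eqP/sep_eq => x.
have sub : [pred x | sep x u z] \subset [pred x | sep x u y].
  apply/fintype.subsetP => t; rewrite !inE /sep; move: (h t).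
  by case: (anc t u); case: (anc t y); case: (anc t z).
have /subset_cardP : #|[pred x | sep x u z]| = #|[pred x | sep x u y]|.
  by apply/eqP; rewrite eqn_leq subset_leq_card.
move=> /(_ sub x); rewrite !inE /sep.
by case: (anc x u); case: (anc x y); case: (anc x z).
Qed.

Definition depth x := #|[pred z | anc z x]|.

Lemma depth_lt x y : anc x y -> x != y -> depth x < depth y.
Proof.
move=> xy; apply: contraNltn => le.
have sub : [pred z | anc z x] \subset [pred z | anc z y].
  by apply/fintype.subsetP => z; rewrite !inE => zx; apply: anc_trans xy.
have /subset_cardP : #|[pred z | anc z x]| = #|[pred z | anc z y]|.
  by apply/eqP; rewrite eqn_leq subset_leq_card.
move=> /(_ sub y); rewrite !inE anc_refl => yx.
by apply/eqP/(@anc_anti V F); rewrite xy.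
Qed.

Lemma lowest_common_ancestor u v : exists w,
  [/\ anc w u, anc w v & forall x, anc x u -> anc x v -> anc x w].
Proof.
have r0 : anc (apex F) u && anc (apex F) v by rewrite !anc_apex.
case: (@arg_maxnP _ _ (fun w => anc w u && anc w v) depth r0).
move=> w /andP[wu wv] h; exists w; split=> // x xu xv.
case/orP: (anc_chain xu wu) => // wx; have [-> | nwx] := eqVneq w x.
  exact: anc_refl.
by move: (h x); rewrite xu xv => /(_ isT) /=; rewrite leqNgt depth_lt.
Qed.

Lemma parent_exists x : x != apex F -> exists p,
  [/\ p != x, anc p x & forall z, anc z x -> z != x -> anc z p].
Proof.
move=> xr; have r0 : anc (apex F) x && (apex F != x).
  by rewrite anc_apex eq_sym.
case: (@arg_maxnP _ _ (fun p => anc p x && (p != x)) depth r0).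
move=> p /andP[px np] h; exists p; split=> // z zx nz.
case/orP: (anc_chain zx px) => // pz; have [-> | npz] := eqVneq p z.
  exact: anc_refl.
by move: (h z); rewrite zx nz => /(_ isT) /=; rewrite leqNgt depth_lt.
Qed.

(* [conn B] is the relation of lying in the same component of the tree with
   the vertices of [B] removed. *)
Definition conn B u v := [forall b, B b ==> ~~ btw u b v].

Lemma connP B u v : reflect (forall b, B b -> ~~ btw u b v) (conn B u v).
Proof.
by apply: (iffP forallP) => h b; [apply/implyP | apply/implyP/h].
Qed.

Lemma connPn B u v : reflect (exists2 b, B b & btw u b v) (~~ conn B u v).
Proof.
apply: (iffP idP) => [|[b Bb ub]].
  by rewrite negb_forall => /existsP[b]; rewrite negb_imply negbK => /andP[]; exists b.
by apply/connP => /(_ b Bb); rewrite ub.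
Qed.

Lemma connC B u v : conn B u v = conn B v u.
Proof. by apply: eq_forallb => b; rewrite btwC. Qed.

Lemma conn_trans B u v w : conn B u v -> conn B v w -> conn B u w.
Proof.
move=> /connP h1 /connP h2; apply/connP => b Bb; apply/negP => /(@btw_split _ _ _ v).
by rewrite (negbTE (h1 b Bb)) (negbTE (h2 b Bb)).
Qed.

Lemma conn_btw B u v z : conn B u v -> btw u z v -> conn B u z.
Proof.
move=> /connP h uzv; apply/connP => b Bb; apply: contra (h b Bb).
exact: btw_transl.
Qed.

Lemma conn_refl B u : conn B u u = ~~ B u.
Proof.
apply/connP/idP => [h|nB b Bb].
  by apply/negP => /h; rewrite btwl.
by apply: contra nB => /btw_refl <-.
Qed.

Lemma conn_notin B u v : conn B u v -> ~~ B u.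
Proof. by move=> c; rewrite -conn_refl; apply: conn_btw c (btwl _ _). Qed.

(** Take the highest ancestor of [u] in its component. The lowest common ancestor of [u] and another
    member is on the path between them, hence in the component, so it cannot be strictly higher. *)
Lemma conn_top B u : ~~ B u ->
  exists2 t, conn B u t & forall v, conn B u v -> anc t v.
Proof.
move=> nB; have r0 : anc u u && conn B u u by rewrite anc_refl conn_refl.
case: (@arg_minnP _ _ (fun t => anc t u && conn B u t) depth r0).
move=> t /andP[tu ut] h; exists t => // v uv.
have [w [wu wv wl]] := lowest_common_ancestor u v.
have uwv : btw u w v by apply/btwP; rewrite wu.
apply: anc_trans wv; case/orP: (anc_chain tu wu) => // wt.
have [-> | nwt] := eqVneq w t; first exact: anc_refl.
by move: (h w); rewrite wu (conn_btw uv) // => /(_ isT) /=; rewrite leqNgt depth_lt.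
Qed.

Definition below (X : {set V}) x := #|[set u in X | anc x u]|.

Lemma below_anti (X : {set V}) x y : anc x y -> below X y <= below X x.
Proof.
move=> xy; apply/subset_leq_card/fintype.subsetP => u; rewrite !inE.
by case/andP=> -> /(anc_trans xy) ->.
Qed.

Lemma below_disj (X : {set V}) x y z : anc x y -> anc x z -> ~~ anc y z -> ~~ anc z y ->
  below X y + below X z <= below X x.
Proof.
move=> xy xz nyz nzy; rewrite /below -cardUI [X in _ + X]eq_card0 ?addn0 => [|u].
  apply/subset_leq_card/fintype.subsetP => u; rewrite !inE => /orP[] /andP[->] /=.
    exact: anc_trans.
  exact: anc_trans.
rewrite !inE; apply/negP => /andP[/andP[_ yu] /andP[_ zu]].
by move: (anc_chain yu zu); rewrite (negbTE nyz) (negbTE nzy).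
Qed.

Lemma below_diff (X A : {set V}) x y : anc x y ->
  (forall u, u \in A -> [/\ u \in X, anc x u & ~~ anc y u]) ->
  #|A| + below X y <= below X x.
Proof.
move=> xy hA; rewrite /below -cardUI [X in _ + X]eq_card0 ?addn0 => [|u].
  apply/subset_leq_card/fintype.subsetP => u; rewrite !inE.
  move=> /orP[/hA[-> ->]|/andP[->]] //.
  exact: anc_trans.
rewrite !inE; apply/negP => /andP[/hA[_ _ /negbTE yu]]; by rewrite yu andbF.
Qed.

(** * Centroids of components *)

Section Centroid.
Variable X : {set V}.

(** The centroid is a deepest vertex of the component having at least half of the component's points
    of [X] below it; the top of the component shows that such vertices exist. *)
Lemma centroid_exists B u : ~~ B u -> exists2 c, conn B u c &
  forall v, conn B u v ->
    #|[set x in X | conn (predU1 c B) v x]| <= #|[set x in X | conn B u x]|./2.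
Proof.
move=> nB; set A := [set x in X | conn B u x].
have [t ut tl] := conn_top nB.
pose P c := conn B u c && (#|A| <= (below A c).*2).
have Pt : P t.
  rewrite /P ut -addnn; apply: leq_trans (leq_addr _ _).
  apply/subset_leq_card/fintype.subsetP => x xA; rewrite inE xA.
  by apply: tl; move: xA; rewrite inE => /andP[].
case: (arg_maxnP depth Pt) => c /andP[uc hc] cmax; exists c => // v uv.
have BB w : conn (predU1 c B) v w -> conn B u w.
  move=> vw; apply: conn_trans uv _; apply/connP => b Bb.
  by move/connP: vw => /(_ b); rewrite /= Bb orbT; apply.
have cB w : conn (predU1 c B) v w -> ~~ btw v c w.
  by move/connP/(_ c); rewrite /= eqxx; apply.
set A' := [set _ in X | _].
have hA' x : x \in A' -> x \in A.
  by rewrite !inE => /andP[-> /BB].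
have half_le m n : m.*2 <= n -> m <= n./2.
  by move=> h; rewrite -(doubleK m); apply: half_leq.
apply: half_le.
case/boolP: (conn (predU1 c B) v v) => [|nvv]; last first.
  suff -> : A' = finset.set0 by rewrite cards0.
  apply/setP => x; rewrite !inE; apply/negbTE; rewrite negb_and orbC.
  by apply/orP; left; apply: contra nvv => /conn_notin; rewrite conn_refl.
rewrite conn_refl => nv'; have [t' vt' t'l] := conn_top nv'.
(* A piece below [c] has its top strictly below [c], so by the choice of [c] fewer than half of the
   points lie below that top. *)
case/boolP: (anc c v) => cv.
  have ct' : anc c t'.
    apply: contraR (cB _ vt') => nct'; apply: sep_btw.
    by rewrite /sep cv (negbTE nct').
  have nt' : c != t'.
    by apply: contraNneq (cB _ vt') => <-; rewrite btwr.
  have : ~~ P t'.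
    by apply/negP => /cmax /=; rewrite leqNgt depth_lt.
  rewrite /P BB //= -ltnNge => /ltnW; apply: leq_trans.
  rewrite leq_double; apply/subset_leq_card/fintype.subsetP => x xA'.
  by rewrite inE hA' //= t'l //; move: xA'; rewrite inE => /andP[].
(* A piece not below [c] is disjoint from the at least half of [A] that is below [c]. *)
have : #|A'| + below A c <= below A (apex F).
  apply: below_diff => [|x xA']; first exact: anc_apex.
  split; rewrite ?hA' ?anc_apex //; apply/negP => cx.
  have /cB/negP : conn (predU1 c B) v x by move: xA'; rewrite inE => /andP[].
  by apply; apply: sep_btw; rewrite /sep cx (negbTE cv).
have : below A (apex F) <= #|A|.
  by apply/subset_leq_card/fintype.subsetP => x; rewrite inE => /andP[].
move: hc; set a := #|A|; set b := below _ _; set d := #|A'|; move=> h1 h2 h3.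
have := leq_trans h3 h2; rewrite -leq_double doubleD => h4.
rewrite -(leq_add2r a); apply: leq_trans (leq_trans _ h4) _.
  by rewrite leq_add2l.
by rewrite -addnn.
Qed.

End Centroid.

End RootedOrder.

(** * Loads and short monotone routes *)

Section Edges.
Variables (V : finType) (F : rooted_order V).
Implicit Types (u v w x y z : V) (B : pred V) (E : seq (V * V)).
Local Notation anc := (ancestor F).
Local Notation sep := (sep F).
Local Notation btw := (btw F).
Local Notation conn := (conn F).

Definition load E x := count (fun e => sep x e.1 e.2) E.

Lemma load_cat E1 E2 x : load (E1 ++ E2) x = load E1 x + load E2 x.
Proof. exact: count_cat. Qed.

Definition link E u v := ((u, v) \in E) || ((v, u) \in E).

Lemma link_sub E1 E2 u v : {subset E1 <= E2} -> link E1 u v -> link E2 u v.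
Proof. by move=> s /orP[] /s h; rewrite /link h ?orbT. Qed.

(* [reach E k u v]: at most [k] edges of [E] lead from [u] to [v], meeting the
   vertices of the tree path in order. *)
Fixpoint reach E k u v : bool :=
  (u == v) ||
  (if k is k'.+1 then [exists c, [&& link E u c, btw u c v & reach E k' c v]]
   else false).

Lemma reach_refl E k u : reach E k u u.
Proof. by case: k => [|k] /=; rewrite eqxx. Qed.

Lemma reach_step E k u c v :
  link E u c -> btw u c v -> reach E k c v -> reach E k.+1 u v.
Proof.
by move=> uc b r /=; apply/orP; right; apply/existsP; exists c; rewrite uc b.
Qed.

Lemma reach_link E u v : link E u v -> reach E 1 u v.
Proof. by move=> l; apply: reach_step l (btwr F u v) (reach_refl _ _ _). Qed.

Lemma reach_sub E1 E2 k u v :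
  {subset E1 <= E2} -> reach E1 k u v -> reach E2 k u v.
Proof.
move=> s; elim: k u => [|k IH] u //= /orP[-> //|/existsP[c /and3P[l b r]]].
apply/orP; right; apply/existsP; exists c; by rewrite (link_sub s l) b IH.
Qed.

Lemma reach_leq E k l u v : k <= l -> reach E k u v -> reach E l u v.
Proof.
elim: k l u => [|k IH] [|l] u //=; first by move=> _; rewrite orbF => ->.
move=> kl /orP[-> //|/existsP[c /and3P[e b r]]].
apply/orP; right; apply/existsP; exists c; by rewrite e b (IH l).
Qed.

Lemma reach_trans E k l u c v :
  btw u c v -> reach E k u c -> reach E l c v -> reach E (k + l) u v.
Proof.
elim: k u => [|k IH] u b; first by rewrite add0n /= orbF => /eqP ->.
case/orP => [/eqP -> |]; first exact/reach_leq/leq_addl.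
case/existsP => d /and3P[e b1 r1] r2; rewrite addSn.
apply: reach_step e (btw_transl b b1) _.
by apply: IH r1 r2; apply: btw_transr b b1.
Qed.

Lemma count_enum_le (T : finType) (A S : {pred T}) (p : pred T) :
  (forall i, i \in A -> p i -> i \in S) -> count p (enum A) <= #|S|.
Proof.
move=> h; rewrite -size_filter cardE; apply: uniq_leq_size.
  exact/filter_uniq/enum_uniq.
by move=> i; rewrite mem_filter !mem_enum => /andP[pi iA]; apply: h.
Qed.

Lemma complete_edges (X : {set V}) : exists E,
  (forall x, load E x <= #|X| * #|X|) /\ {in X &, forall u v, reach E 1 u v}.
Proof.
exists (enum (finset.setX X X)); split=> [x|u v uX vX].
  rewrite -cardsX; exact: count_enum_le.
by apply: reach_link; rewrite /link mem_enum inE uX vX.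
Qed.

(** Centroid decomposition of all components at once: adding one centroid per component to [B]
    halves the bound [m]. A level of the recursion costs a load of at most its bound, and these
    bounds sum to at most [2 m]. *)
Lemma two_hop_edges (X : {set V}) m B :
  (forall u, #|[set x in X | conn B u x]| <= m) -> exists E,
  (forall x, load E x <= m.*2) /\
  {in X &, forall u v, conn B u v -> reach E 2 u v}.
Proof.
elim/ltn_ind: m B => [[|m] IH] B hB.
  exists [::]; split=> // u v uX vX uv; move: (hB u).
  rewrite leqn0 cards_eq0 => /eqP/setP/(_ u).
  by rewrite !inE uX conn_refl (conn_notin uv).
pose is_centroid (A : {set V}) c := (c \in A) && [forall v in A,
  #|[set x in X | conn (predU1 c B) v x]| <= m.+1./2].
(* The choice depends on the component as a set, so all vertices of a component get the same
   centroid. *)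
pose cent (A : {set V}) := odflt (apex F) [pick c | is_centroid A c].
pose comp u := [set v | conn B u v].
have compE u v : conn B u v -> comp u = comp v.
  move=> uv; apply/setP => w; rewrite !inE; apply/idP/idP.
    by apply: conn_trans; rewrite connC.
  exact: conn_trans.
have centP u : ~~ B u -> is_centroid (comp u) (cent (comp u)).
  move=> nB; rewrite /cent; case: pickP => // /= none.
  have [c uc hc] := centroid_exists F X nB.
  have /negP[] := negbT (none c); rewrite /is_centroid inE uc /=.
  apply/forall_inP => v; rewrite inE => uv; apply: leq_trans (hc v uv) _.
  exact: half_leq (hB u).
pose B' := [pred b | B b || [exists u, ~~ B u && (b == cent (comp u))]].
have BB' u v : conn B' u v -> conn B u v.
  by move=> /connP h; apply/connP => b Bb; apply: h; rewrite /= Bb.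
have hB' u : #|[set x in X | conn B' u x]| <= m.+1./2.
  case/boolP: (conn B' u u) => [|nuu]; last first.
    rewrite (_ : [set _ in X | _] = finset.set0) ?cards0 //; apply/setP => x.
    rewrite !inE; apply/negbTE; rewrite negb_and orbC.
    by apply/orP; left; apply: contra nuu => /conn_notin; rewrite conn_refl.
  move=> uu; have nB := conn_notin (BB' _ _ uu).
  have /andP[_ /forall_inP/(_ u)] := centP u nB.
  rewrite inE conn_refl => /(_ nB); apply: leq_trans.
  apply/subset_leq_card/fintype.subsetP => x; rewrite !inE => /andP[-> /= /connP h].
  apply/connP => b /= /orP[/eqP -> |Bb]; apply: h; rewrite /= ?Bb //.
  by apply/orP; right; apply/existsP; exists u; rewrite nB eqxx.
have lt : m.+1./2 < m.+1 by rewrite ltn_half_double -addnn -ltn_subLR // subnn.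
have [E' [load' reach']] := IH _ lt _ hB'.
pose S := [set u in X | ~~ B u].
exists ([seq (u, cent (comp u)) | u <- enum S] ++ E'); split=> [x|u v uX vX uv].
  rewrite load_cat -addnn leq_add //; last first.
    apply: leq_trans (load' x) _; rewrite -leq_double.
    by rewrite -{2}(odd_double_half m.+1) doubleD leq_addl.
  (* If the edge of [x] separates [u] from its centroid, then [x] is on the path between them, so
     [u] is in the component of [x]. *)
  rewrite /load count_map; apply: leq_trans (hB x).
  apply: count_enum_le => u; rewrite !inE => /andP[uX nB] /= /sep_btw ux.
  rewrite uX connC; apply: conn_btw ux.
  by have /andP[+ _] := centP u nB; rewrite inE.
case/boolP: (conn B' u v) => [c|].
  by apply: reach_sub (reach' _ _ uX vX c) => e; rewrite mem_cat orbC => ->.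
(* The path meets a new vertex [b] of [B']. It is the centroid of some component, which must be that
   of [u] and [v], so both are linked to it. *)
case/connPn => b Bb ub.
have cub := conn_btw uv ub; have nb : ~~ B b.
  by rewrite connC in cub; apply: conn_notin cub.
move: Bb; rewrite /= (negbTE nb) => /existsP[w /andP[nw /eqP eb]].
have wb : conn B w b by have /andP[+ _] := centP w nw; rewrite inE -eb.
have nu := conn_notin uv; have nv : ~~ B v.
  by rewrite connC in uv; apply: conn_notin uv.
have ebu : b = cent (comp u) by rewrite (compE u b) // -(compE w b).
have ebv : b = cent (comp v) by rewrite -(compE u v).
have link_c t : t \in X -> ~~ B t -> b = cent (comp t) ->
    (t, b) \in [seq (u, cent (comp u)) | u <- enum S] ++ E'.
  move=> tX nt ->; rewrite mem_cat; apply/orP; left; apply/mapP.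
  by exists t; rewrite // mem_enum inE tX.
refine (reach_step (k := 1) _ ub _).
  by rewrite /link link_c.
by apply: reach_link; rewrite /link link_c ?orbT.
Qed.

End Edges.

(** * Hubs *)

Lemma card_dep_pairs (T1 T2 : finType) (P : pred T1) (Q : T1 -> pred T2) :
  #|[set e | P e.1 && Q e.1 e.2]| = \sum_(w | P w) #|[set u | Q w u]|.
Proof.
rewrite -sum1_card (eq_bigl (fun e => P e.1 && Q e.1 e.2)) => [|e]; last by rewrite inE.
rewrite -(pair_big_dep P Q (fun _ _ => 1)) /=; apply: eq_bigr => w _.
by rewrite -sum1_card; apply: eq_bigl => u; rewrite inE.
Qed.

Section Hubs.
Variables (V : finType) (F : rooted_order V) (X : {set V}) (l : nat).
Hypothesis l_gt0 : 0 < l.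
Implicit Types (u v w x y z : V).
Local Notation anc := (ancestor F).
Local Notation sep := (sep F).
Local Notation btw := (btw F).
Local Notation conn := (conn F).

Definition level x := below F X x %/ l.

Definition hub y :=
  (0 < level y) && [forall w, anc y w && (level w == level y) ==> (w == y)].

Lemma level_anti x y : anc x y -> level y <= level x.
Proof. by move=> xy; apply/leq_div2r/below_anti. Qed.

(** Otherwise the points below [y] and [z] are disjoint, and together they number at least
    [(level x + 1) * l], too many to lie below [x]. *)
Lemma level_comparable x y z : anc x y -> anc x z -> level y = level x ->
  0 < level z -> anc y z || anc z y.
Proof.
move=> xy xz e z0; rewrite -[_ || _]negbK negb_or; apply/negP => /andP[n1 n2].
have := below_disj X xy xz n1 n2.
have : level x * l + l <= below F X y + below F X z.
  by rewrite -e leq_add ?leq_divM // -[X in X <= _]mul1n -leq_divRL.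
move=> h1 h2; have := leq_trans h1 h2.
by rewrite addnC -mulSn -leq_divRL // ltnn.
Qed.

Lemma hub_uniq y w : hub y -> anc y w -> level y <= level w -> w = y.
Proof.
case/andP=> _ /forallP/(_ w)/implyP h yw le; apply/eqP/h.
by rewrite yw eqn_leq le level_anti.
Qed.

Lemma hub_below x : 0 < level x ->
  exists y, [/\ hub y, anc x y & level y = level x].
Proof.
move=> x0; have P0 : anc x x && (level x == level x) by rewrite anc_refl eqxx.
case: (@arg_maxnP _ _ (fun y => anc x y && (level y == level x)) (depth F) P0).
move=> y /andP[xy /eqP e] h; exists y; split=> //; rewrite /hub e x0.
apply/forallP => w; apply/implyP => /andP[yw ew]; rewrite eq_sym.
apply: contraT => nyw; have := h w; rewrite (anc_trans xy yw) ew => /(_ isT) /=.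
by rewrite leqNgt depth_lt.
Qed.

(** With two or more terms, the predecessors alone save 2; a single term is handled by its strict
    bound [g w < n]. *)
Lemma sum_pred_double (M : {set V}) (g : V -> nat) (n : nat) :
  (forall w, w \in M -> 0 < g w < n) -> \sum_(w in M) g w <= n ->
  \sum_(w in M) (g w).*2.-1 <= n.*2.-2.
Proof.
move=> h s; have e : \sum_(w in M) (g w).*2.-1 + #|M| = (\sum_(w in M) g w).*2.
  rewrite -sum1_card -big_split -mul2n big_distrr; apply: eq_bigr => w /h.
  by case: (g w) => //= k _; rewrite mul2n doubleS addn1.
case c: #|M| e => [|[|k]] e.
- by rewrite big1 // => w; rewrite (cards0_eq c) inE.
- have /cards1P[w Mw] : #|M| == 1 by rewrite c.
  move: (h w); rewrite Mw big_set1 inE eqxx => /(_ isT) /andP[_].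
  case: n {h s} => // n; rewrite ltnS doubleS /= => le.
  by apply: leq_trans (leq_pred _) _; rewrite leq_double.
have : \sum_(w in M) (g w).*2.-1 + 2 <= n.*2.
  apply: leq_trans (_ : (\sum_(w in M) g w).*2 <= _); last by rewrite leq_double.
  by rewrite -e leq_add2l.
by rewrite addn2; case: (n.*2) => [|[|N]].
Qed.

(** Induction from the leaves up. If [level v] is positive, some hub [y] below [v] has the same
    level, and all other hubs below [v] are strictly below [y]. The topmost of these, forming [M],
    have smaller levels whose sum is at most [level y]. *)
Lemma card_hub_below v : #|[set y | hub y && anc v y]| <= (level v).*2.-1.
Proof.
have [n] := ubnP (#|V| - depth F v); elim: n v => // n IH v hn.
have [v0|v0] := posnP (level v).
  rewrite v0 leqn0 cards_eq0; apply/eqP/setP => y; rewrite !inE.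
  apply/negP => /andP[/andP[y0 _] /level_anti].
  by rewrite leqNgt v0 y0.
have [y [hy vy ey]] := hub_below v0.
pose P := [pred w | [&& hub w, anc y w & w != y]].
pose M := [set w | P w && [forall z, P z && anc z w ==> (z == w)]].
have MP w : w \in M -> P w by rewrite inE => /andP[].
have exM z : P z -> exists2 w, w \in M & anc w z.
  move=> Pz; have P0 : P z && anc z z by rewrite anc_refl andbT.
  case: (@arg_minnP _ _ (fun w => P w && anc w z) (depth F) P0).
  move=> w /andP[Pw wz] h; exists w => //; rewrite inE Pw; apply/forallP => t.
  apply/implyP => /andP[Pt tw]; apply: contraT => ntw.
  by have := h t; rewrite Pt (anc_trans tw wz) leqNgt depth_lt // => /(_ isT).
have M_incomp w w' u : w \in M -> w' \in M -> anc w u -> anc w' u -> w = w'.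
  move=> Mw Mw' wu wu'; have := Mw; rewrite inE => /andP[Pw /forallP/(_ w')].
  have := Mw'; rewrite inE => /andP[Pw' /forallP/(_ w)]; rewrite Pw Pw' /=.
  by case/orP: (anc_chain wu wu') => -> /= /eqP // _ /eqP.
move: M MP exM M_incomp => M MP exM M_incomp.
have sub : [set y | hub y && anc v y] \subset
   y |: snd @: [set e | (e.1 \in M) && (hub e.2 && anc e.1 e.2)].
  apply/fintype.subsetP => z; rewrite !inE => /andP[hz vz].
  case: eqVneq => //= zy; have z0 : 0 < level z by case/andP: hz.
  have yz : anc y z.
    case/orP: (level_comparable vy vz ey z0) => // zy'.
    have : y = z by apply: (hub_uniq hz zy'); rewrite ey level_anti.
    by move/eqP; rewrite eq_sym (negbTE zy).
  have [|w Mw wz] := exM z; first by rewrite /= hz yz.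
  by apply/imsetP; exists (w, z) => //; rewrite inE /= Mw hz.
apply: leq_trans (subset_leq_card sub) _.
apply: leq_trans (_ : (\sum_(w in M) #|[set z | hub z && anc w z]|).+1 <= _).
  rewrite cardsU1 -add1n leq_add ?leq_b1 // -card_dep_pairs.
  exact: leq_imset_card.
have dn w : w \in M -> #|V| - depth F w < n.
  move/MP => /and3P[_ yw nyw]; have vw := anc_trans vy yw.
  have lt : depth F v < depth F w.
    apply: depth_lt vw _; apply: contra nyw => /eqP e.
    by apply/eqP/(@anc_anti V F); rewrite yw -e vy.
  move: hn; rewrite ltnS; apply: leq_trans; apply: ltn_sub2l => //.
  by apply: leq_trans lt _; apply: max_card.
apply: leq_ltn_trans (_ : \sum_(w in M) (level w).*2.-1 < _).
  by apply: leq_sum => w /dn /IH.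
have : \sum_(w in M) (level w).*2.-1 <= (level v).*2.-2.
  rewrite -ey; apply: sum_pred_double => [w /MP /and3P[hw yw nyw]|].
    have /andP[-> _] /= := hw; rewrite ltnNge; apply: contra nyw => le.
    by rewrite (hub_uniq hy yw le).
  rewrite leq_divRL // big_distrl /=.
  apply: leq_trans (_ : \sum_(w in M) below F X w <= _).
    by apply: leq_sum => w _; apply: leq_divM.
  (* The sets of points below the members of [M] are disjoint: a pair of a member and a point below
     it is determined by the point. *)
  rewrite -(card_dep_pairs (mem M) (fun w u => (u \in X) && anc w u)).
  rewrite -(card_in_imset (f := snd)); last first.
    move=> [w u] [w' u']; rewrite !inE /= => /and3P[Mw _ wu] /and3P[Mw' _ wu'] e.
    by rewrite -e in wu' *; rewrite (M_incomp w w' u).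
  apply/subset_leq_card/fintype.subsetP => u' /imsetP[[w u] + ->].
  rewrite !inE /= => /and3P[Mw -> wu]; apply: anc_trans wu.
  by have /and3P[] := MP w Mw.
by case: (level v) v0 => // k _; rewrite doubleS.
Qed.

Lemma card_hub : #|[set y | hub y]| * l <= #|X|.*2.
Proof.
have -> : [set y | hub y] = [set y | hub y && anc (apex F) y].
  by apply/setP => y; rewrite !inE anc_apex andbT.
apply: leq_trans (_ : (level (apex F)).*2 * l <= _).
  by rewrite leq_mul2r (leq_trans (card_hub_below _)) ?orbT ?leq_pred.
rewrite -doubleMl leq_double; apply: leq_trans (leq_divM _ _) _.
by apply/subset_leq_card/fintype.subsetP => u; rewrite inE => /andP[].
Qed.

(** A hub [y] below [x] with the level of [x] cuts off everything below it, and the counts below [x]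
    and [y] differ by less than [l] because their quotients by [l] agree. At level 0 there are fewer
    than [l] points below [x]. *)
Lemma card_conn_below x : #|[set u in X | anc x u && conn hub x u]| <= l.
Proof.
have [x0|x0] := posnP (level x).
  apply/ltnW; rewrite -(mul1n l) -ltn_divLR //.
  rewrite ltnS -x0; apply/leq_div2r/subset_leq_card/fintype.subsetP => u; rewrite !inE.
  by case/and3P=> -> -> _.
have [y [hy xy ey]] := hub_below x0.
have : #|[set u in X | anc x u && conn hub x u]| + below F X y <= below F X x.
  apply: below_diff => // u; rewrite inE => /and3P[uX xu /connP/(_ y hy) n].
  split=> //; apply: contra n => yu; apply/btwP; rewrite yu orbT; split=> // z zx _.
  exact: anc_trans xy.
move=> le; rewrite -(leq_add2r (level x * l)) -mulSn; apply/ltnW.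
apply: (@leq_ltn_trans (below F X x)); last by rewrite -ltn_divLR.
by apply: leq_trans le; rewrite leq_add2l -ey leq_divM.
Qed.

Lemma card_conn x : #|[set u in X | conn hub x u]| <= l.
Proof.
case/boolP: (hub x) => hx.
  rewrite (_ : [set _ in X | _] = finset.set0) ?cards0 //; apply/setP => u.
  rewrite !inE; apply/negbTE; rewrite negb_and orbC; apply/orP; left.
  by apply/negP => /conn_notin; rewrite hx.
have [t xt tl] := conn_top F hx.
apply: leq_trans (card_conn_below t).
apply/subset_leq_card/fintype.subsetP => u; rewrite !inE => /andP[-> xu] /=.
by rewrite tl //=; apply: conn_trans xu; rewrite connC.
Qed.

(** The visible hubs bound the component of [u]; a vertex that is itself a hub sees only itself. *)
Definition visible u y := hub y && [forall z, hub z && btw u z y ==> (z == y)].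

Lemma visibleP u y :
  reflect (hub y /\ forall z, hub z -> btw u z y -> z = y) (visible u y).
Proof.
apply: (iffP andP) => -[hy h]; split=> //.
  move=> z hz b; apply/eqP; move/forallP/(_ z)/implyP: h; apply; by rewrite hz.
by apply/forallP => z; apply/implyP => /andP[hz /h ->].
Qed.

Lemma anc_btw u y z : anc y z -> anc z u -> btw u z y.
Proof. by move=> yz zu; apply/btwP; rewrite zu; split=> // t _ /anc_trans; apply. Qed.

(** The lowest common ancestor [w] of [u] and [y] has a hub of its own level below it, comparable
    with [y]. This hub is [y]: if above [y] it would hide [y] from [u], and if below, its level
    would contradict that [y] is a hub. *)
Lemma visible_below u y : visible u y -> ~~ anc y u ->
  exists w, [/\ anc w u, anc w y & level w = level y].
Proof.
case/visibleP=> hy vis nyu.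
have [w [wu wy wl]] := lowest_common_ancestor F u y.
exists w; split=> //; have /andP[y0 _] := hy.
have w0 : 0 < level w by apply: leq_trans y0 (level_anti wy).
have [z [hz wz ez]] := hub_below w0.
suff <- : z = y by [].
case/orP: (level_comparable wz wy ez y0) => [zy|yz].
  apply: vis => //; apply/btwP; rewrite zy orbT; split=> // t tu ty.
  exact: anc_trans (wl t tu ty) wz.
by apply: (hub_uniq hy yz); rewrite ez level_anti.
Qed.

Lemma visible_anc_uniq u y z :
  visible u y -> visible u z -> anc y u -> anc z u -> y = z.
Proof.
move=> /visibleP[hy vy] /visibleP[hz vz] yu zu.
case/orP: (anc_chain yu zu) => h; first by rewrite (vy z) //; apply: anc_btw.
by rewrite (vz y) //; apply: anc_btw.
Qed.

(** The branching points given by [visible_below] are both above [u], hence comparable; at the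
    higher one [level_comparable] makes [y] and [z] comparable, and the higher hub would hide the
    lower one. *)
Lemma visible_nanc_uniq u y z :
  visible u y -> visible u z -> ~~ anc y u -> ~~ anc z u -> y = z.
Proof.
have comp a b w : anc b a -> ~~ anc b u -> anc w u -> anc w a -> anc w b.
  move=> ba nbu wu wa; case/orP: (anc_chain wa ba) => // bw.
  by rewrite (anc_trans bw wu) in nbu.
have main a b : visible u a -> visible u b -> ~~ anc a u -> ~~ anc b u ->
    anc b a -> a = b.
  move=> /visibleP[ha va] /visibleP[hb vb] nau nbu ba; symmetry; apply: va => //.
  apply/btwP; rewrite ba orbT; split=> // x xu xa; exact: comp ba nbu xu xa.
move=> vy vz ny nz.
have [w [wu wy ew]] := visible_below vy ny.
have [w' [wu' wz ew']] := visible_below vz nz.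
have := main y z vy vz ny nz; have := main z y vz vy nz ny => h1 h2.
have /andP[y0 _] : hub y by case/visibleP: vy.
have /andP[z0 _] : hub z by case/visibleP: vz.
suff /orP[/h1|/h2] : anc y z || anc z y by [].
case/orP: (anc_chain wu wu') => ww.
  exact: level_comparable wy (anc_trans ww wz) (esym ew) z0.
by rewrite orbC; apply: level_comparable wz (anc_trans ww wy) (esym ew') y0.
Qed.

Lemma card_visible u : #|[set y | visible u y]| <= 2.
Proof.
rewrite -(cardsID [set y | anc y u]) -addn1.
have le1 (S : {set V}) : (forall y z, y \in S -> z \in S -> y = z) -> #|S| <= 1.
  by move=> h; apply/card_le1_eqP => y z yS zS; apply: h.
apply: leq_add; apply: le1 => y z; rewrite !inE => /andP[h1 h2] /andP[h3 h4].
  exact: visible_anc_uniq h2 h4.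
exact: visible_nanc_uniq h1 h3.
Qed.

(** Only [y] is a hub on the path from [u] to [y], so an endpoint other than [y] of an edge on this
    path is in the component of [u]. Here [p] is the parent of [x], used when [x] is [y]. *)
Lemma visible_crossing x : exists p, forall u y, visible u y -> sep x u y ->
  conn hub x u || conn hub p u.
Proof.
have vis_conn u y z : visible u y -> btw u z y -> z != y -> conn hub z u.
  move=> /visibleP[hy vy] b nzy; rewrite connC; apply/connP => t ht.
  apply: contra nzy => ut; have e := vy t ht (btw_transl b ut); subst t.
  rewrite btwC in b; rewrite btwC in ut; apply/eqP.
  exact: btw_anti ut b.
have [xr|xr] := eqVneq x (apex F).
  by exists x => u y _; rewrite /sep xr !anc_apex.
have [p [px xp pl]] := parent_exists xr; exists p => u y vis s.
have b := sep_btw s; have [e|nxy] := eqVneq x y; last by rewrite (vis_conn u y).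
subst y; rewrite (vis_conn u x p) ?orbT //; apply/btwP; rewrite xp orbT; split=> //.
move=> t tu tx; apply: pl => //; apply: contraTneq s => e; subst t.
by rewrite /sep tu anc_refl.
Qed.

Lemma first_hub u v : ~~ conn hub u v -> exists2 y, visible u y & btw u y v.
Proof.
case/connPn => b hb ub; have P0 : hub b && btw u b v by rewrite hb.
case: (@arg_minnP _ _ (fun b => hub b && btw u b v) (sep_dist F u) P0).
move=> y /andP[hy uy] h; exists y => //; apply/visibleP; split=> // z hz uz.
apply/eqP; apply: contraT => nzy; have := h z.
by rewrite hz (btw_transl uy uz) leqNgt sep_dist_lt // => /(_ isT).
Qed.

Lemma hub_step k (E' : seq (V * V)) :
  {in hub &, forall y z, reach F E' k y z} -> exists E,
  (forall x, load F E x <= 6 * l + load F E' x) /\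
  {in X &, forall u v, reach F E k.+2 u v}.
Proof.
move=> hE'.
have [E2 [load2 reach2]] := two_hop_edges card_conn.
pose E1 := enum [set e : V * V | (e.1 \in X) && visible e.1 e.2].
exists (E1 ++ E2 ++ E'); split=> [x|u v uX vX].
  rewrite !load_cat addnA leq_add2r -[6]/(4 + 2) mulnDl leq_add //; last first.
    by rewrite mul2n load2.
  (* The share [4 l] comes from two components of at most [l] points, each point seeing at most two
     hubs; [E2] adds [2 l]. *)
  have [p hp] := visible_crossing x.
  pose U := [set u in X | conn hub x u] :|: [set u in X | conn hub p u].
  have cU : #|U| <= 2 * l.
    by rewrite mul2n -addnn (leq_trans (leq_card_setU _ _)) ?leq_add ?card_conn.
  apply: leq_trans (_ : #|[set e | (e.1 \in U) && visible e.1 e.2]| <= _).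
    apply: count_enum_le => -[u y]; rewrite !inE /= => /andP[-> vis] /(hp _ _ vis).
    by rewrite vis andbT.
  rewrite (card_dep_pairs (mem U) visible) -[4]/(2 * 2) -mulnA.
  apply: leq_trans (_ : \sum_(w in U) 2 <= _).
    by apply: leq_sum => w _; apply: card_visible.
  by rewrite sum_nat_const mulnC leq_mul2l cU orbT.
have s1 : {subset E1 <= E1 ++ E2 ++ E'} by move=> e; rewrite !mem_cat => ->.
have s2 : {subset E2 <= E1 ++ E2 ++ E'}.
  by move=> e; rewrite !mem_cat => ->; rewrite orbT.
have s3 : {subset E' <= E1 ++ E2 ++ E'}.
  by move=> e; rewrite !mem_cat => ->; rewrite !orbT.
case/boolP: (conn hub u v) => [uv|].
  by apply: (@reach_leq _ _ _ 2) => //; apply: reach_sub s2 (reach2 _ _ uX vX uv).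
case/first_hub => y vy uyv; have /visibleP[hy _] := vy.
have : ~~ conn hub v y by apply/connPn; exists y => //; apply: btwr.
(* Searching from [v] only as far as [y] ensures that [u], [y], [z], [v] occur in this order on the
   path. *)
case/first_hub => z vz vzy; have /visibleP[hz _] := vz.
have l1 : link E1 u y by rewrite /link mem_enum inE /= uX vy.
have l2 : link E1 z v by rewrite /link !mem_enum !inE /= vX vz orbT.
rewrite -addn1; apply: reach_trans (_ : btw u z v) _ _.
- by rewrite btwC; apply: btw_transl vzy; rewrite btwC.
- apply: reach_step (link_sub s1 l1) _ (reach_sub s3 (hE' _ _ hy hz)).
  by rewrite btwC; apply: btw_transr vzy; rewrite btwC.
by apply/reach_link/(link_sub s1 l2).
Qed.

End Hubs.

(** Two hops cost a load of [6 l = 12 q^2], within the [24 q^2] by which the bound grows from [k] to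
    [k + 2]. The recursion ends with at most one vertex, or with all pairs of at most [q]
    vertices. *)
Lemma light_edges (V : finType) (F : rooted_order V) (q k : nat) (X : {set V}) :
  0 < q -> #|X| <= q ^ k -> exists E,
  (forall x, load F E x <= 12 * k * q ^ 2) /\ {in X &, forall u v, reach F E k u v}.
Proof.
move=> q0; have [n] := ubnP k; elim: n k X => // n IH [|[|k]] X kn hX.
- exists [::]; split=> // u v uX vX; rewrite (_ : u = v) ?reach_refl //.
  by move/card_le1_eqP: hX; apply.
- have [E [h1 h2]] := complete_edges F X; exists E; split=> // x.
  apply: leq_trans (h1 x) _; rewrite expn1 in hX.
  apply: leq_trans (leq_mul hX hX) _; rewrite muln1 -mulnn.
  exact: leq_pmull.
have l0 : 0 < 2 * q ^ 2 by rewrite muln_gt0 expn_gt0 q0.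
(* There are at most [2 |X| / l = |X| / q^2] hubs, which is why [l = 2 q^2]. *)
have hY : #|[set y | hub F X (2 * q ^ 2) y]| <= q ^ k.
  rewrite -(leq_pmul2r l0); apply: leq_trans (card_hub F X l0) _.
  by rewrite mulnCA mul2n leq_double -expnD addn2.
have [|E' [load' reach']] := IH k _ _ hY; first exact: ltnW kn.
have [|E [h1 h2]] := @hub_step V F X _ l0 k E'.
  by move=> y z hy hz; apply: reach'; rewrite inE.
exists E; split=> // x; apply: leq_trans (h1 x) _.
apply: leq_trans (leq_add (leqnn _) (load' x)) _.
by rewrite mulnA -mulnDl leq_mul2r -(addn2 k) mulnDr (addnC (6 * 2)) leq_add2l orbT.
Qed.

(** * Paths in trees *)

Local Open Scope ring_scope.

(** After the common initial part, follow the first path to its first vertex [z] on the second one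
    and return along the second: this closes a cycle. *)
Lemma acyclic_path_uniq (V : finType) (G : sgraph V) u v p q :
  acyclic G -> is_path G u v p -> is_path G u v q -> p = q.
Proof.
move=> aG; elim: p u q => [|a p IH] u [|b q] //.
- move=> /and3P[_ /= /eqP e _] /and3P[_ /= /eqP l /andP[/negP nu _]].
  by case: nu; rewrite e -l mem_last.
- move=> /and3P[_ /= /eqP l /andP[/negP nu _]] /and3P[_ /= /eqP e _].
  by case: nu; rewrite e -l mem_last.
have [<- /and3P[/= /andP[_ pp] lp /andP[_ up]]|nab] := eqVneq a b.
  case/and3P=> /= /andP[_ pq] lq /andP[_ uq].
  by rewrite (IH a q) // /is_path ?pp ?lp ?pq ?lq.
move=> /and3P[pp lp up] /and3P[pq lq uq].
have : has (mem (b :: q)) (a :: p).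
  apply/hasP; exists v; first by rewrite -(eqP lp) /= mem_last.
  by rewrite /= -(eqP lq) /= mem_last.
have [s e] : exists s, a :: p = s by exists (a :: p).
have [s' e'] : exists s', b :: q = s' by exists (b :: q).
rewrite {1}e {1}e' => hs; move: e; case/split_find: hs => z p1 p2 /= zq np1 e.
move: e' np1; case/splitPr: zq => q1 q2 e' np1.
(* The cycle has more than two vertices, for if [p1] and [q1] were both empty, then [a] and [b]
   would both be [z]. *)
case: (aG (u :: p1 ++ z :: rev q1)).
  rewrite /= size_cat /= size_rev addnS !ltnS lt0n addn_eq0 !size_eq0.
  apply: contraNN nab => /andP[/eqP p10 /eqP q10].
  by move: e e'; rewrite p10 q10 => -[-> _] [-> _].
have [pp1 zp1] : path G u p1 /\ G (last u p1) z.
  by move: pp; rewrite e cat_path rcons_path => /andP[/andP[]].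
have pq1 : path G u (rcons q1 z).
  by move: pq; rewrite e' -cat_rcons cat_path => /andP[].
apply/andP; split.
  rewrite /= rcons_cat cat_path pp1 /= zp1 /=.
  have := rev_path G u (rcons q1 z); rewrite last_rcons belast_rcons rev_cons => ->.
  by rewrite (eq_path (e' := G)) // => x y; rewrite adj_sym.
move: up; rewrite e cons_uniq cat_rcons mem_cat inE !negb_or cat_uniq.
move=> /andP[/and3P[up1 uz _] /and3P[u1 _ _]].
move: uq; rewrite e' cons_uniq mem_cat inE !negb_or cat_uniq /= negb_or.
move=> /andP[/and3P[uq1 _ _] /and3P[u2 /andP[zq1 _] _]].
rewrite mem_cat inE mem_rev !negb_or up1 uz uq1 cat_uniq u1 cons_uniq mem_rev.
rewrite rev_uniq u2 zq1 !andbT; apply/hasPn => x; rewrite inE mem_rev => xz.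
apply/negP => xp; move/hasPn: np1 => /(_ x xp) /=; rewrite mem_cat inE.
by case/predU1P: xz => [->|->]; rewrite ?eqxx ?orbT.
Qed.

(** * The ancestor order of a rooted tree *)

Section TreeOrder.
Variables (V : finType) (G : sgraph V) (treeG : is_tree G) (r : V).

Definition root_path v : seq V := xget [::] [set p : seq V | is_path G r v p]%classic.
Local Notation P := root_path.

Lemma root_pathP v : is_path G r v (P v).
Proof. by rewrite /P; case: xgetP => // h; have [p /h] := treeG.1 r v. Qed.

Lemma root_pathE v p : is_path G r v p -> P v = p.
Proof. by move=> h; apply: acyclic_path_uniq treeG.2 (root_pathP v) h. Qed.

Lemma root_path_last v : last r (P v) = v.
Proof. by have /and3P[_ /eqP] := root_pathP v. Qed.

Lemma root_path_inj : injective P.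
Proof. by move=> u v e; rewrite -(root_path_last u) e root_path_last. Qed.

Lemma root_path_cat v p1 p2 : P v = p1 ++ p2 -> P (last r p1) = p1.
Proof.
move=> e; apply: root_pathE; have /and3P[+ _ +] := root_pathP v.
rewrite e cat_path -cat_cons cat_uniq => /andP[pp _] /andP[up _].
by rewrite /is_path pp up eqxx.
Qed.

(** As a prefix order on root paths, ancestry inherits its order laws from sequences. *)
Definition tree_anc : rel V := fun x v => prefix (P x) (P v).

Lemma tree_ancE x v : tree_anc x v = (x \in r :: P v).
Proof.
apply/idP/idP => [/prefixP[s e]|].
  by rewrite e -cat_cons mem_cat -{1}(root_path_last x) mem_last.
move e: (P v) => p xp; move: e; case/splitPl: xp => p1 p2 <- e.
by rewrite /tree_anc e (root_path_cat e) prefix_prefix.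
Qed.

Lemma tree_anc_refl : reflexive tree_anc.
Proof. by move=> x; apply: prefix_refl. Qed.

Lemma tree_anc_trans : transitive tree_anc.
Proof. by move=> y x z; apply: prefix_trans. Qed.

Lemma tree_anc_anti : antisymmetric tree_anc.
Proof.
move=> x y /andP[xy yx]; apply: root_path_inj.
have sz : size (P x) = size (P y) by apply/eqP; rewrite eqn_leq !size_prefix.
by move: xy; rewrite /tree_anc prefixE sz take_size => /eqP.
Qed.

Lemma tree_anc_chain x y v :
  tree_anc x v -> tree_anc y v -> tree_anc x y || tree_anc y x.
Proof.
rewrite /tree_anc; wlog le : x y / (size (P x) <= size (P y))%N => [hw xv yv|].
  by case/orP: (leq_total (size (P x)) (size (P y))) => /hw; last rewrite orbC; apply.
rewrite !prefixE => /eqP ex /eqP ey; apply/orP; left.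
by rewrite -ey -take_min (minn_idPl le) ex.
Qed.

Lemma tree_anc_root v : tree_anc r v.
Proof. by rewrite tree_ancE mem_head. Qed.

Definition tree_order : rooted_order V :=
  RootedOrder tree_anc_refl tree_anc_trans tree_anc_anti tree_anc_chain
    tree_anc_root.

End TreeOrder.

(** * Monotone paths, cut distances and crossing numbers *)

Section Monotone.
Variables (V : finType) (F : rooted_order V).
Implicit Types (u v c : V) (p : seq V).
Local Notation sep := (sep F).
Local Notation btw := (btw F).

(** Unlike in [reach], steps that stay in place are excluded, so that these paths are simple. *)
Fixpoint monotone u p v : bool :=
  if p is c :: p' then [&& c != u, btw u c v & monotone c p' v] else u == v.

Lemma monotone_last u p v : monotone u p v -> last u p = v.
Proof. by elim: p u => [|c p IH] u /= => [/eqP|/and3P[_ _ /IH]]. Qed.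

Lemma monotone_btw u p v z : monotone u p v -> z \in u :: p -> btw u z v.
Proof.
elim: p u => [|c p IH] u m; first by rewrite inE => /eqP ->; apply: btwl.
rewrite inE => /orP[/eqP -> | zp]; first exact: btwl.
case/and3P: m => _ b /IH/(_ zp); rewrite btwC => bz.
by rewrite btwC; apply: btw_transl bz; rewrite btwC.
Qed.

Lemma monotone_uniq u p v : monotone u p v -> uniq (u :: p).
Proof.
elim: p u => [|c p IH] u //= /and3P[nc b m]; rewrite -/(uniq (c :: p)) IH // andbT.
apply/negP => up; have bc := monotone_btw m up.
by rewrite (btw_anti b bc) eqxx in nc.
Qed.

Lemma reach_monotone E k u v : reach F E k u v ->
  exists p, [/\ monotone u p v, (size p <= k)%N &
    path [rel x y | (x != y) && link E x y] u p].
Proof.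
elim: k u => [|k IH] u /=; first by rewrite orbF => e; exists [::].
case/orP => [e|]; first by exists [::].
case/existsP => c /and3P[l b /IH[p [m s pp]]].
have [ecu|ncu] := eqVneq c u; last first.
  by exists (c :: p); rewrite /= (eq_sym u c) ncu b m l pp.
by subst c; exists p; rewrite (leqW s).
Qed.

Variables (R : realType) (W : V -> R).

Definition cut_dist u v : R := \sum_x W x * (sep x u v)%:R.

Lemma cut_distC u v : cut_dist u v = cut_dist v u.
Proof. by apply: eq_bigr => x _; rewrite sepC. Qed.

Lemma cut_dist_btw u c v : btw u c v ->
  cut_dist u v = cut_dist u c + cut_dist c v.
Proof.
move=> /forallP h; rewrite -big_split; apply: eq_bigr => x _ /=.
rewrite -mulrDr -natrD /sep; congr (_ * _%:R); move: (h x).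
by case: (ancestor F x u); case: (ancestor F x v); case: (ancestor F x c).
Qed.

(** Agreement with [cut_dist] is required on the edges of [e] only, so this applies both to [wt]
    along tree edges and to the tree metric along any pairs. *)
Lemma monotone_weight (d : V -> V -> R) (e : rel V) u p v :
  (forall x y, e x y -> d x y = cut_dist x y) ->
  monotone u p v -> path e u p -> path_weight d u p = cut_dist u v.
Proof.
move=> ed; elim: p u => [|c p IH] u /=.
  by move=> /eqP -> _; rewrite /cut_dist big1 // => x _; rewrite sepxx mulr0.
by move=> /and3P[_ b m] /andP[uc pp]; rewrite IH // ed // (cut_dist_btw b).
Qed.

(** Both orientations of an edge are counted, matching the division by 2 in [graph_weight]. *)
Definition cross (S : rel V) x := #|[pred e : V * V | S e.1 e.2 && sep x e.1 e.2]|.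

Lemma graph_weight_cross (d : V -> V -> R) (S : sgraph V) :
  (forall u v, d u v = cut_dist u v) ->
  graph_weight d S = (\sum_x W x * (cross S x)%:R) / 2.
Proof.
move=> dE; rewrite /graph_weight; congr (_ / _); rewrite pair_big_dep /=.
under eq_bigr => e _ do rewrite dE.
rewrite exchange_big; apply: eq_bigr => x _; rewrite -big_distrr -natr_sum /=.
congr (_ * _%:R); rewrite /cross -sum1_card [in RHS]big_mkcondr /=.
by apply: eq_bigr => e _; case: (sep _ _ _).
Qed.

Lemma cross_load (S : rel V) E x : (forall u v, S u v -> link E u v) ->
  (cross S x <= (load F E x).*2)%N.
Proof.
move=> SE; rewrite -addnn.
pose E' := E ++ [seq (e.2, e.1) | e <- E].
apply: leq_trans (_ : size [seq e <- E' | sep x e.1 e.2] <= _)%N.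
  rewrite /cross cardE; apply: uniq_leq_size (enum_uniq _) _ => -[u v].
  rewrite mem_enum mem_filter inE /= => /andP[/SE l ->] /=.
  rewrite mem_cat; case/orP: l => [-> //|l]; apply/orP; right.
  by apply/mapP; exists (v, u).
rewrite size_filter count_cat count_map leq_add2l.
by apply: sub_count => e /=; rewrite sepC.
Qed.

(** A path of [S] from [x] to the apex must leave the subtree of [x]; the edge where it does so
    counts in both orientations. *)
Lemma cross_ge2 (S : sgraph V) x :
  connected_graph S -> x != apex F -> (2 <= cross S x)%N.
Proof.
move=> cS xr; have crossing p u : path S u p -> sep x u (last u p) ->
    exists a b, S a b /\ sep x a b.
  elim: p u => [|c p IH] u /=; first by rewrite sepxx.
  move=> /andP[uc pp] s; case/boolP: (sep x u c) => [|n]; first by exists u, c.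
  by apply: IH pp _; move: s n; rewrite /sep negbK => s /eqP <-.
have [p /and3P[pp /eqP lp _]] := cS x (apex F).
have [|a [b [ab sab]]] := crossing p x pp.
  rewrite lp /sep anc_refl; apply: contraNN xr => /eqP e; apply/eqP.
  by apply: (@anc_anti V F); rewrite anc_apex -e.
have nab : (a, b) != (b, a).
  by apply: contraTneq sab => -[-> _]; rewrite sepxx.
apply: (@leq_trans #|[set (a, b); (b, a)]|); first by rewrite cards2 nab.
apply/subset_leq_card/fintype.subsetP => e; rewrite !inE => /orP[]/eqP -> /=.
  by rewrite ab.
by rewrite adj_sym ab sepC.
Qed.

End Monotone.

(** * The tree metric as a cut distance *)

Section TreeMetric.
Variables (R : realType) (V : finType) (T : wtree R V) (r : V).
Local Notation P := (root_path T r).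
Local Notation F := (tree_order (tgraph_tree T) r).

Lemma root_path_root : P r = [::].
Proof. by apply: (root_pathE (tgraph_tree T)); rewrite /is_path /= eqxx. Qed.

Lemma root_path_rcons p x : P x = rcons p x -> tgraph T (last r p) x.
Proof.
have /and3P[+ _ _] := root_pathP (tgraph_tree T) r x.
by move=> + e; rewrite e rcons_path => /andP[].
Qed.

Lemma root_path_edge a b :
  tgraph T a b -> P b = rcons (P a) b \/ P a = rcons (P b) a.
Proof.
move=> ab; have tT := tgraph_tree T.
have /and3P[pa /eqP la ua] := root_pathP tT r a.
have [ba|nba] := boolP (b \in r :: P a); last first.
  left; apply: (root_pathE tT); rewrite /is_path rcons_path pa la ab last_rcons.
  by rewrite eqxx -rcons_cons rcons_uniq nba ua.
right; apply: (root_pathE tT).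
have /and3P[pb /eqP lb ub] := root_pathP tT r b.
rewrite /is_path rcons_path pb lb adj_sym ab last_rcons eqxx.
rewrite -rcons_cons rcons_uniq ub !andbT /= -(tree_ancE tT); apply/negP => aPb.
rewrite -(tree_ancE tT) in ba.
have e : a = b by apply: (@tree_anc_anti _ _ tT r); rewrite aPb.
by rewrite e adj_irr in ab.
Qed.

Lemma sep_edge a b x : P b = rcons (P a) b -> sep F x a b = (x == b).
Proof.
move=> e; have tT := tgraph_tree T.
have /and3P[_ _ ub] := root_pathP tT r b.
rewrite /sep /= !(tree_ancE tT); rewrite e in ub *.
move: ub; rewrite -!rcons_cons rcons_uniq mem_rcons inE => /andP[nb _].
have [->|] := eqVneq x b; first by rewrite (negbTE nb).
by rewrite /= eqxx.
Qed.

Definition parent x := last r (belast r (P x)).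

(** The root stands for no edge, hence its weight 0. *)
Definition up_weight x : R := if x == r then 0 else wt T (parent x) x.

Lemma parent_rcons a b : P b = rcons (P a) b -> parent b = a.
Proof.
by move=> e; rewrite /parent e belast_rcons /= (root_path_last (tgraph_tree T)).
Qed.

Lemma root_path_parent x : x != r -> P x = rcons (P (parent x)) x.
Proof.
have tT := tgraph_tree T; have l := root_path_last tT r x.
case/lastP e: (P x) l => [|p y]; first by move=> /= ->; rewrite eqxx.
rewrite last_rcons => ey _; subst y; congr rcons.
rewrite /parent e belast_rcons /=; symmetry.
by apply: (root_path_cat tT (v := x) (p2 := [:: x])); rewrite cats1.
Qed.

Lemma parent_adj x : x != r -> tgraph T (parent x) x.
Proof.
move=> /root_path_parent/root_path_rcons.
by rewrite (root_path_last (tgraph_tree T)).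
Qed.

Lemma up_weight_ge0 x : 0 <= up_weight x.
Proof.
rewrite /up_weight; case: eqVneq => // xr; exact/ltW/wt_gt0/parent_adj.
Qed.

Lemma wt_cut_dist a b : tgraph T a b -> wt T a b = cut_dist F up_weight a b.
Proof.
move=> ab; wlog e : a b ab / P b = rcons (P a) b => [hw|].
  case: (root_path_edge ab) => e; first exact: hw.
  by rewrite cut_distC wt_sym // hw // adj_sym.
rewrite /cut_dist (bigD1 b) //= big1 => [|x nx]; last first.
  by rewrite (sep_edge x e) (negbTE nx) mulr0.
rewrite (sep_edge b e) eqxx mulr1 addr0 /up_weight (parent_rcons e).
case: eqVneq => // br; move: e; rewrite br root_path_root.
by move/(congr1 size); rewrite size_rcons.
Qed.

(** If [u] is above [v], the next vertex is the child of [u] towards [v]; otherwise it is the parent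
    of [u]. *)
Lemma tree_next u v : u != v -> exists2 c, tgraph T u c & btw F u c v.
Proof.
move=> nuv; have tT := tgraph_tree T.
case/boolP: (ancestor F u v) => [uv|nuv'].
  case/prefixP: (uv) => -[|c s] e.
    by rewrite cats0 in e; rewrite (root_path_inj tT e) eqxx in nuv.
  have Pc : P c = rcons (P u) c.
    rewrite -cat_rcons in e; have := root_path_cat tT e.
    by rewrite last_rcons.
  have uc := root_path_rcons Pc; rewrite (root_path_last tT) in uc.
  exists c => //; apply/btwP; split=> [|x xu _].
    by apply/orP; right; apply/prefixP; exists s; rewrite Pc cat_rcons.
  by apply: anc_trans xu _; apply/prefixP; exists [:: c]; rewrite cats1.
have ur : u != r by apply: contraNneq nuv' => ->; apply: (anc_apex F).
have e := root_path_parent ur; exists (parent u).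
  by rewrite adj_sym parent_adj.
apply/btwP; split=> [|x xu xv].
  by apply/orP; left; apply/prefixP; exists [:: u]; rewrite cats1.
have := sep_edge x e; rewrite /sep xu; case: (eqVneq x u) => [exu|_].
  by rewrite exu (negbTE nuv') in xv.
by case: (ancestor F x _).
Qed.

Lemma tree_monotone_path u v : exists2 p, monotone F u p v & path T u p.
Proof.
have [n] := ubnP (sep_dist F v u); elim: n u => // n IH u hn.
have [->|nuv] := eqVneq u v; first by exists [::] => /=.
have [c uc b] := tree_next nuv.
have ncu : c != u by apply: contraTneq uc => ->; rewrite adj_irr.
have [|p m pp] := IH c.
  by rewrite ltnS in hn; apply: leq_trans hn; apply: sep_dist_lt => //; rewrite btwC.
by exists (c :: p); rewrite /= ?ncu ?b ?uc.
Qed.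

Lemma tree_dist_cut u v : tree_dist T u v = cut_dist F up_weight u v.
Proof.
have [p m pp] := tree_monotone_path u v.
have hp : is_path T u v p.
  by rewrite /is_path pp (monotone_last m) eqxx (monotone_uniq m).
rewrite /tree_dist; case: xgetP => [q _ hq|/(_ p)//].
rewrite (acyclic_path_uniq (tgraph_tree T).2 hq hp).
exact: monotone_weight wt_cut_dist m pp.
Qed.

Lemma mst_weight_ge : \sum_x up_weight x <= mst_weight (tree_dist T).
Proof.
apply: lb_le_inf.
  by exists (graph_weight (tree_dist T) T), (tgraph T) => //; apply: tgraph_tree.
move=> _ [S [cS _] <-]; rewrite (graph_weight_cross _ tree_dist_cut) mulr_suml.
apply: ler_sum => x _; have [->|xr] := eqVneq x r.
  by rewrite /up_weight eqxx !mul0r.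
rewrite -mulrA ler_peMr ?up_weight_ge0 // ler_pdivlMr // mul1r ler_nat.
exact: (@cross_ge2 _ F).
Qed.

Lemma light_spanner (q k : nat) : (0 < q)%N -> (#|V| <= q ^ k)%N ->
  exists H : sgraph V, hop_diameter (tree_dist T) 1 H k /\
    graph_weight (tree_dist T) H <= (12 * k * q ^ 2)%:R * \sum_x up_weight x.
Proof.
move=> q0; rewrite -cardsT => hq.
have [E [hload hreach]] := light_edges F q0 hq.
have sH : symmetric [rel x y : V | (x != y) && link E x y].
  by move=> x y /=; rewrite eq_sym /link orbC.
have iH : irreflexive [rel x y : V | (x != y) && link E x y].
  by move=> x /=; rewrite eqxx.
exists (SGraph sH iH); split=> [u v|].
  have [|p [m sp pp]] := @reach_monotone V F E k u v.
    by apply: hreach; rewrite inE.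
  exists p; split=> //.
    by rewrite /is_path pp (monotone_last m) eqxx (monotone_uniq m).
  rewrite mul1r tree_dist_cut.
  by rewrite (monotone_weight (fun x y _ => tree_dist_cut x y) m pp).
rewrite (graph_weight_cross _ tree_dist_cut) mulr_suml mulr_sumr.
apply: ler_sum => x _; rewrite -mulrA mulrC ler_wpM2r ?up_weight_ge0 //.
rewrite ler_pdivrMr // -natrM ler_nat muln2.
apply: leq_trans (_ : (load F E x).*2 <= _)%N; last by rewrite leq_double.
by apply: cross_load => u v /andP[].
Qed.

End TreeMetric.

(** * Choice of parameters and conclusion *)

Lemma hop_diameter_spanner (R : realType) (V : finType) (d : V -> V -> R) t H k :
  hop_diameter d t H k -> spanner d t H.
Proof.
move=> h u v; have [p [hp _ le]] := h u v.
apply: (@le_trans _ _ (path_weight d u p)%:E); last by rewrite lee_fin.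
by apply: ereal_inf_lbound; exists p.
Qed.

(** Take [q] to be the integer part of [n^(1/k)] plus 1. Since [n^(1/k)] is at least 1, [q] is at
    most twice it, whence the factor 4. *)
Lemma ceil_root (R : realType) (n k : nat) : (1 <= n)%N -> (1 <= k)%N ->
  exists q : nat, [/\ (0 < q)%N, (n <= q ^ k)%N &
    (q ^ 2)%:R <= 4 * n%:R `^ (2 / k%:R) :> R].
Proof.
move=> n1 k1; set a : R := n%:R `^ k%:R^-1.
have a1 : 1 <= a.
  have <- : 1 `^ k%:R^-1 = 1 :> R by rewrite powR1.
  by rewrite ge0_ler_powR ?nnegrE ?ler1n.
have a0 : 0 <= a := le_trans ler01 a1.
have /andP[lea lta] := truncn_itv a0.
exists (Num.truncn a).+1; split=> //.
  rewrite -(ler_nat R) natrX; have <- : a ^+ k = n%:R.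
    rewrite -powR_mulrn // /a -powRrM mulVf ?powRr1 //.
    by rewrite pnatr_eq0 -lt0n.
  by rewrite lerXn2r ?nnegrE // ltW.
have -> : n%:R `^ (2 / k%:R) = a ^+ 2.
  by rewrite -powR_mulrn // /a -powRrM mulrC.
rewrite natrX (_ : 4 = 2 ^+ 2); last by rewrite -natrX.
rewrite -exprMn lerXn2r ?nnegrE ?mulr_ge0 //.
by rewrite -natr1 mulr2n mulrDl mul1r lerD.
Qed.

Theorem theorem1p1 (R : realType) :
  exists C : R, 0 < C /\
    forall (n k : nat), (1 <= n)%N -> (1 <= k)%N ->
    forall (V : finType), #|V| = n ->
    forall T : wtree R V,
    exists H : sgraph V,
      [/\ spanner (tree_dist T) 1 H,
          hop_diameter (tree_dist T) 1 H k &
          lightness (tree_dist T) H <= C * k%:R * n%:R `^ (2 / k%:R)].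
Proof.
(* The constant is 12 from the load times 4 from rounding the root. *)
exists 48; split=> // n k n1 k1 V Vn T.
have [r _] : exists r : V, r \in V by apply/card_gt0P; rewrite Vn.
have [q [q0 nq qle]] := ceil_root R n1 k1.
rewrite -Vn in nq; have [H [hop le]] := light_spanner T r q0 nq.
exists H; split=> //; first exact: hop_diameter_spanner hop.
set B := _ `^ _ in qle *; have B0 : 0 <= B by apply: powR_ge0.
have W0 : 0 <= \sum_x up_weight T r x by apply: sumr_ge0 => x _; apply: up_weight_ge0.
have Wm := mst_weight_ge T r; rewrite /lightness.
(* This covers the one-point tree, where the lightness is 0 by the convention for division by
   zero. *)
have [->|m0] := eqVneq (mst_weight (tree_dist T)) 0.
  by rewrite invr0 mulr0 !mulr_ge0.
have m_gt0 : 0 < mst_weight (tree_dist T).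
  by rewrite lt_neqAle eq_sym m0 (le_trans W0).
rewrite ler_pdivrMr //; apply: le_trans le _; apply: ler_pM => //.
rewrite 2!natrM (_ : 48 = 12 * 4); last by rewrite -natrM.
by rewrite -!mulrA ler_wpM2l // (mulrCA 4) ler_wpM2l.
Qed.
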